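(* Let $S\subseteq\mathbb{N}^d$ be a local good semigroup, $E\subsetneq S$ a proper good ideal, and suppose $A=S\setminus E$ is well-behaved. Let $I=\{1,\dots,d\}=I_1\sqcup I_2$ with $I_1,I_2$ nonempty, and for $h=1,2$ let $\pi_h$ be the projection onto the coordinates in $I_h$, $S_h=\pi_h(S)$, $E_h=\pi_h(E)$ (a good semigroup and a good ideal of it), $A^{(h)}=S_h\setminus E_h$ with levels $A^{(h)}_1,A^{(h)}_2,\dots$ computed in $S_h$. If $\boldsymbol\alpha^{(1)}\in A^{(1)}_i$, then $$\Gamma(\boldsymbol\alpha^{(1)}):=\{\boldsymbol\alpha\in S:\pi_1(\boldsymbol\alpha)=\boldsymbol\alpha^{(1)}\}\subseteq A_i.$$ Analogously, if $\boldsymbol\alpha^{(2)}\in A^{(2)}_i$, then $\{\boldsymbol\alpha\in S:\pi_2(\boldsymbol\alpha)=\boldsymbol\alpha^{(2)}\}\subseteq A_i$.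
   Context: Notation: on $\mathbb{Z}^d$, $\le$ componentwise, $<$ means $\le$ and $\ne$, $\boldsymbol\alpha\ll\boldsymbol\beta$ means $\alpha_i<\beta_i$ for all $i$, $\boldsymbol\alpha\le\le\boldsymbol\beta$ means $\boldsymbol\alpha=\boldsymbol\beta$ or $\boldsymbol\alpha\ll\boldsymbol\beta$, $\wedge$ componentwise minimum. For $T\subseteq\mathbb Z^d$, $F\subseteq I$: $\Delta^T_F(\boldsymbol\alpha)=\{\boldsymbol\beta\in T:\beta_i=\alpha_i\ (i\in F),\ \beta_j>\alpha_j\ (j\notin F)\}$, $\widetilde\Delta^T_F(\boldsymbol\alpha)=\{\boldsymbol\beta\in T:\beta_i=\alpha_i\ (i\in F),\ \beta_j\ge\alpha_j\ (j\notin F)\}\setminus\{\boldsymbol\alpha\}$. A good semigroup is a submonoid $S$ of $(\mathbb{N}^d,+)$ closed under $\wedge$ (G1), satisfying (G2): if $\boldsymbol\alpha\neq\boldsymbol\beta\in S$ and $\alpha_i=\beta_i$, there is $\boldsymbol\epsilon\in S$ with $\epsilon_i>\alpha_i$, $\epsilon_j\ge\min\{\alpha_j,\beta_j\}$ for $j\ne i$, with equality if $\alpha_j\ne\beta_j$; and (G3): $\boldsymbol c+\mathbb N^d\subseteq S$ for some $\boldsymbol c$. Local: $\boldsymbol 0$ is the only element with a zero component. A good ideal is $E\subseteq S$ with $E+S\subseteq E$ satisfying (G1)–(G3). Complete infimum: $\boldsymbol\alpha\in B\subseteq S$ is a complete infimum of $\boldsymbol\beta^{(1)},\dots,\boldsymbol\beta^{(r)}\in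 B$ ($r\ge 2$) if $\boldsymbol\beta^{(j)}\in\Delta^S_{F_j}(\boldsymbol\alpha)$ with $\emptyset\ne F_j\subsetneq I$, $\boldsymbol\beta^{(j)}\wedge\boldsymbol\beta^{(k)}=\boldsymbol\alpha$ for $j\ne k$, $\bigcap F_j=\emptyset$. Levels of $A=S\setminus E$: $B^{(1)}$ = maximal elements of $A$ for $\le\le$, $C^{(1)}$ = those that are complete infima of $r$ elements of $B^{(1)}$, $1<r\le d$, $D^{(1)}=B^{(1)}\setminus C^{(1)}$; inductively $B^{(i)}$ = maximal elements for $\le\le$ of $A\setminus\bigcup_{j<i}D^{(j)}$, $C^{(i)},D^{(i)}$ likewise; $A=\bigsqcup_{i=1}^ND^{(i)}$, levels $A_i=D^{(N+1-i)}$ (for $d=1$ these are the singletons of $A$ in increasing order). Well-behaved: $A$ is well-behaved if whenever $\boldsymbol\alpha\in S$ is a complete infimum (in $S$) of $\boldsymbol\beta^{(1)},\dots,\boldsymbol\beta^{(r)}$ with $\boldsymbol\beta^{(j)}\in\widetilde\Delta^S_{G_j}(\boldsymbol\alpha)$ and $\widetilde\Delta^S_{G_j}(\boldsymbol\alpha)\subseteq A$ for every $j$, then $\boldsymbol\alpha\in E$. *)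

(* Defs.v *)
From mathcomp Require Import all_boot.
Set Implicit Arguments. Unset Strict Implicit. Unset Printing Implicit Defensive.

Definition vec (T : finType) := {ffun T -> nat}.
Definition vset (T : finType) := vec T -> Prop.

Section GoodDefs.
Variable T : finType.
Local Notation vec := (vec T).
Local Notation vset := (vset T).

Definition vle (a b : vec) := forall i, a i <= b i.
Definition vll (a b : vec) := forall i, a i < b i.
Definition vmin (a b : vec) : vec := [ffun i => minn (a i) (b i)].
Definition vadd (a b : vec) : vec := [ffun i => a i + b i].
Definition vzero : vec := [ffun _ => 0].

Definition G1 (X : vset) := forall a b, X a -> X b -> X (vmin a b).
Definition G2 (X : vset) := forall a b i, X a -> X b -> a <> b -> a i = b i ->
  exists e, X e /\ a i < e i /\
    (forall j, j != i -> minn (a j) (b j) <= e j /\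
                        (a j <> b j -> e j = minn (a j) (b j))).
Definition G3 (X : vset) := exists c : vec, forall a, vle c a -> X a.

Definition good_semigroup (S : vset) :=
  [/\ S vzero, (forall a b, S a -> S b -> S (vadd a b)), G1 S, G2 S & G3 S].

Definition local (S : vset) :=
  forall a, S a -> (exists i, a i = 0) -> a = vzero.

Definition good_ideal (S E : vset) :=
  [/\ (forall a, E a -> S a), (forall a s, E a -> S s -> E (vadd a s)),
      G1 E, G2 E & G3 E].

Definition Delta (X : vset) (F : {set T}) (a b : vec) :=
  [/\ X b, (forall i, i \in F -> b i = a i) & (forall i, i \notin F -> a i < b i)].
Definition Deltat (X : vset) (F : {set T}) (a b : vec) :=
  [/\ X b, (forall i, i \in F -> b i = a i), (forall i, i \notin F -> a i <= b i)
    & b <> a].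

Definition complete_infimum (S B : vset) (a : vec) (r : nat)
    (beta : 'I_r -> vec) (F : 'I_r -> {set T}) :=
  [/\ 2 <= r, B a,
      (forall j, [/\ B (beta j), F j != set0, F j != setT & Delta S (F j) a (beta j)]),
      (forall j k, j != k -> vmin (beta j) (beta k) = a)
    & \bigcap_(j < r) F j = set0].

Definition well_behaved (S E : vset) :=
  forall a r (beta : 'I_r -> vec) (F G : 'I_r -> {set T}),
    complete_infimum S S a beta F ->
    (forall j, Deltat S (G j) a (beta j) /\
               (forall x, Deltat S (G j) a x -> S x /\ ~ E x)) ->
    E a.

Definition maximal (X : vset) (a : vec) := X a /\ ~ (exists b, X b /\ vll a b).

Definition is_cinf (S B : vset) (a : vec) :=
  exists r (beta : 'I_r -> vec) (F : 'I_r -> {set T}),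
    r <= #|T| /\ complete_infimum S B a beta F.

Definition Dof (S X : vset) (a : vec) :=
  maximal X a /\ ~ is_cinf S (maximal X) a.

(* Rem k = A \ (D^(1) u ... u D^(k)); D^(k+1) = Dof S (Rem k) *)
Fixpoint Rem (S A : vset) (k : nat) : vset :=
  match k with
  | 0 => A
  | k'.+1 => fun x => Rem S A k' x /\ ~ Dof S (Rem S A k') x
  end.

Definition nlevels (S A : vset) (N : nat) :=
  (forall x, ~ Rem S A N x) /\ (forall M, M < N -> exists x, Rem S A M x).

(* level A_i = D^(N+1-i), 1 <= i <= N *)
Definition level (S A : vset) (i : nat) (a : vec) :=
  exists N, [/\ nlevels S A N, 1 <= i <= N & Dof S (Rem S A (N - i)) a].

End GoodDefs.

Definition setdiff (T : finType) (X Y : vset T) : vset T := fun x => X x /\ ~ Y x.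

Definition proj (T : finType) (J : {set T}) (a : vec T) : vec {i : T | i \in J} :=
  [ffun i => a (val i)].

Definition proj_set (T : finType) (J : {set T}) (X : vset T) : vset {i : T | i \in J} :=
  fun y => exists x, X x /\ proj J x = y.

Arguments proj {T} J a.
Arguments proj_set {T} J X _.

(* Main.v *)
(* For a unit step from a to a + e_i, record the [gap]: 1 if some element of S
   above a keeps the i-th coordinate of a but no element of E does, else 0.
   Property (G2) makes the number of gaps along a lattice path depend only on
   its endpoints, so there is a potential g with g a = gap a i + g (a + e_i),
   vanishing far out; for value semigroups of rings g a is the length of
   R(a) / I(a).  An element a of A survives k rounds of removing levels iff
   k < g a.  Hence A has g 0 levels and the level of a is one more than the
   number of gaps along any path from 0 to a.

   To reach a, first raise the coordinates in J: the gaps met are those met in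
   the projection, since the other coordinates are still 0.  Raising the
   remaining coordinates meets no gap, by well-behavedness. *)
Require Import Defs.
From mathcomp Require Import all_boot boolp zify.
Set Implicit Arguments. Unset Strict Implicit. Unset Printing Implicit Defensive.

(** * Unit steps and induction along lattice paths *)

Definition incr (T : finType) (a : vec T) (i : T) : vec T :=
  [ffun j => a j + (j == i)].

Lemma incrE (T : finType) (a : vec T) i j : incr a i j = a j + (j == i).
Proof. by rewrite ffunE. Qed.

Lemma vle_refl (T : finType) (a : vec T) : vle a a.
Proof. by move=> i. Qed.

Lemma vle_trans (T : finType) (a b c : vec T) : vle a b -> vle b c -> vle a c.
Proof. by move=> ab bc i; apply: leq_trans (ab i) (bc i). Qed.

Lemma vle_incr (T : finType) (a : vec T) i : vle a (incr a i).
Proof. by move=> j; rewrite incrE leq_addr. Qed.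

Lemma incr_vle (T : finType) (a b : vec T) i :
  vle a b -> a i < b i -> vle (incr a i) b.
Proof.
move=> ab lt j; rewrite incrE; case: eqP => [->|_]; first by rewrite addn1.
by rewrite addn0.
Qed.

Lemma incrC (T : finType) (a : vec T) i k : incr (incr a i) k = incr (incr a k) i.
Proof. by apply/ffunP => j; rewrite !incrE addnAC. Qed.

Lemma sum_incr (T : finType) (a b : vec T) i : a i < b i ->
  \sum_j (b j - incr a i j) < \sum_j (b j - a j).
Proof.
move=> lt; rewrite (bigD1 i) //= [ltnRHS](bigD1 i) //= incrE eqxx.
rewrite (eq_bigr (fun j => b j - a j)); last first.
  by move=> j /negbTE ne; rewrite incrE ne addn0.
by rewrite ltn_add2r addn1; lia.
Qed.

(** Induction on the total distance left to [b]: the unit steps trace a monotone lattice path that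
    stays in the box between [a] and [b]. *)
Lemma vle_ind (T : finType) (P : vec T -> Prop) (a b : vec T) :
  vle a b -> P a ->
  (forall x i, vle a x -> vle x b -> x i < b i -> P x -> P (incr x i)) -> P b.
Proof.
have [n] := ubnP (\sum_j (b j - a j)); elim: n a => // n IH a /ltnSE le_n ab Pa step.
case: (pickP (fun i => a i < b i)) => [i lt|ge].
  apply: (IH (incr a i)) => //; first exact: leq_trans (sum_incr lt) le_n.
  - exact: incr_vle.
  - by apply: step => //; apply: vle_refl.
  by move=> x j ax; apply: step; apply: vle_trans ax; apply: vle_incr.
suff -> : b = a by [].
by apply/ffunP => i; apply/eqP; rewrite eqn_leq ab leqNgt ge.
Qed.

(** * Potentials of path-independent step weights *)

Section Potential.
Context (T : finType) (f : vec T -> T -> nat) (c : vec T).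
Context (f_square : forall (a : vec T) i k, i != k ->
  f a i + f (incr a i) k = f a k + f (incr a k) i).
Context (f_vanish : forall (a : vec T) i, c i <= a i -> f a i = 0).

Fixpoint path_sum (a : vec T) (u : seq T) : nat :=
  if u is i :: u' then f a i + path_sum (incr a i) u' else 0.

(** The square relation swaps [i] with each step before it in turn; when the two steps coincide
    there is nothing to swap. *)
Lemma path_sum_rot a u i v : path_sum a (u ++ i :: v) = path_sum a (i :: u ++ v).
Proof.
elim: u a => //= k u IH a; rewrite IH /= !addnA; case: (eqVneq i k) => [->//|ne].
by rewrite f_square 1?eq_sym // incrC.
Qed.

Lemma path_sum_perm a u v : perm_eq u v -> path_sum a u = path_sum a v.
Proof.
elim: u v a => [|i u IH] v a; first by move/perm_size; case: v.
move=> puv; have /splitPr vi : i \in v by rewrite -(perm_mem puv) mem_head.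
case: vi puv => v1 v2 puv; rewrite path_sum_rot /=; congr (_ + _); apply: IH.
by rewrite -(perm_cons i) (permPl puv) (perm_catCA v1 [:: i] v2).
Qed.

(** Truncated subtraction gives no step in a coordinate already beyond [c], so the path ends at the
    join of [a] and [c]. *)
Definition path_to (a : vec T) : seq T :=
  flatten [seq nseq (c i - a i) i | i <- enum T].

Lemma count_path_to a i : count_mem i (path_to a) = c i - a i.
Proof.
rewrite count_flatten -map_comp sumnE big_map big_enum /= (bigD1 i) //= big1.
  by rewrite count_nseq /= eqxx mul1n addn0.
by move=> j /negbTE ne; rewrite count_nseq /= ne.
Qed.

Lemma path_sum_rcons (a : vec T) u i : c i <= a i ->
  path_sum a (rcons u i) = path_sum a u.
Proof.
elim: u a => [|k u IH] a le /=; first by rewrite f_vanish.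
by rewrite IH // (leq_trans le) // vle_incr.
Qed.

Lemma potential_exists : exists g : vec T -> nat,
  (forall (a : vec T) i, g a = f a i + g (incr a i)) /\ (forall a, vle c a -> g a = 0).
Proof.
exists (fun a => path_sum a (path_to a)); split=> [a i|a ca]; last first.
  suff -> : path_to a = [::] by [].
  apply: size0nil; rewrite size_flatten sumnE /shape -map_comp big_map.
  by rewrite big1 // => i _; rewrite /= size_nseq; apply/eqP; rewrite subn_eq0.
have [le|lt] := leqP (c i) (a i).
  (* From here on [f] vanishes in direction [i]: append [i] at no cost, then move it to the front.
     Both truncated differences in coordinate [i] are 0, so [a] and [incr a i] have the same
     path. *)
  rewrite -(path_sum_rcons (path_to a) le).
  rewrite (@path_sum_perm _ _ (i :: path_to a)) ?perm_rcons //=.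
  congr (_ + path_sum _ _); rewrite /path_to; congr flatten; apply: eq_map => j.
  rewrite incrE; case: eqP => [->|_]; last by rewrite addn0.
  by congr nseq; lia.
rewrite (@path_sum_perm _ _ (i :: path_to (incr a i))) // /perm_eq.
apply/allP => j _ /=; rewrite !count_path_to incrE eq_sym.
by case: (eqVneq j i) => [->|_]; apply/eqP; lia.
Qed.

End Potential.

(** * Coordinates kept by elements of a good set, and gaps *)

Lemma vle_anti (T : finType) (a b : vec T) : vle a b -> vle b a -> a = b.
Proof. by move=> ab ba; apply/ffunP => i; apply/eqP; rewrite eqn_leq ab ba. Qed.

Lemma vle_neq (T : finType) (a b : vec T) : vle a b -> b <> a -> exists i, a i < b i.
Proof.
move=> ab ne; case: (pickP (fun i => a i < b i)) => [i lt|ge]; first by exists i.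
by case: ne; apply: vle_anti => // i; rewrite leqNgt ge.
Qed.

Definition good (T : finType) (X : vset T) := [/\ G1 X, G2 X & G3 X].

Definition attains (T : finType) (X : vset T) (a : vec T) (i : T) : bool :=
  `[< exists x, [/\ X x, vle a x & x i = a i] >].

Lemma attains_mem (T : finType) (X : vset T) a i : X a -> attains X a i.
Proof. by move=> Xa; apply/asboolP; exists a; split=> //; apply: vle_refl. Qed.

Lemma attains_sub (T : finType) (X Y : vset T) a i :
  (forall x, X x -> Y x) -> attains X a i -> attains Y a i.
Proof. by move=> XY /asboolP[x [/XY]]; move=> *; apply/asboolP; exists x. Qed.

Lemma attains_incr (T : finType) (X : vset T) (a : vec T) i k : i != k ->
  attains X (incr a i) k -> attains X a k.
Proof.
move=> ne /asboolP[x [Xx ax xk]]; apply/asboolP; exists x; split=> //.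
  by apply: vle_trans ax; apply: vle_incr.
by rewrite xk incrE eq_sym (negbTE ne) addn0.
Qed.

Lemma incr_attains (T : finType) (X : vset T) (a : vec T) i k : i != k ->
  attains X a i -> ~~ attains X a k -> attains X (incr a k) i.
Proof.
move=> ne /asboolP[x [Xx ax xi]] /asboolPn nk; apply/asboolP; exists x; split=> //.
  apply: incr_vle => //; rewrite ltn_neqAle ax andbT; apply/eqP => xk.
  by apply: nk; exists x.
by rewrite incrE (negbTE ne) addn0.
Qed.

(** Let [y] keep [i] above [a], and let [x] keep [k] while raising [i]. If [y] raises [k], it is the
    witness. Otherwise [x] and [y] agree at [k] and differ at [i], and (G2) raises [k] while taking
    the minimum, [a i], at [i]. *)
Lemma incr_attains_G2 (T : finType) (X : vset T) (a : vec T) i k : G2 X -> i != k ->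
  attains X a i -> attains X (incr a i) k -> attains X (incr a k) i.
Proof.
move=> X2 ne /asboolP[y [Xy ay yi]] /asboolP[x [Xx ax xk]].
rewrite incrE eq_sym (negbTE ne) addn0 in xk.
have xi : a i < x i by have := ax i; rewrite incrE eqxx addn1.
apply/asboolP; have [yk|yk] := eqVneq (y k) (a k); last first.
  exists y; split=> //; last by rewrite incrE (negbTE ne) addn0.
  by apply: incr_vle => //; rewrite ltn_neqAle ay eq_sym yk.
have nxy : x <> y by move=> xy; move: xi; rewrite xy yi ltnn.
have [|z [Xz [zk zj]]] := X2 x y k Xx Xy nxy; first by rewrite xk yk.
exists z; split=> //; last first.
  have [_ ->] := zj i ne; rewrite ?incrE ?(negbTE ne) ?addn0 yi; first by lia.
  by lia.
apply: incr_vle; last by rewrite -xk.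
move=> j; case: (eqVneq j k) => [->|jk]; first by rewrite -xk ltnW.
apply: leq_trans (proj1 (zj j jk)); rewrite leq_min ay andbT.
exact: vle_trans (vle_incr a i) ax j.
Qed.

(** The three preceding implications and their mirror images exclude every assignment of the four
    truth values with unequal sums. *)
Lemma attains_square (T : finType) (X : vset T) (a : vec T) i k : G2 X -> i != k ->
  attains X a i + attains X (incr a i) k = attains X a k + attains X (incr a k) i.
Proof.
move=> X2 ne; have nk : k != i by rewrite eq_sym.
move: (attains_incr (X := X) (a := a) ne) (attains_incr (X := X) (a := a) nk).
move: (incr_attains (X := X) (a := a) ne) (incr_attains (X := X) (a := a) nk).
move: (incr_attains_G2 (a := a) X2 ne) (incr_attains_G2 (a := a) X2 nk).
by do 4!case: (attains _ _ _) => //=; intuition.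
Qed.

Lemma attains_big (T : finType) (X : vset T) (a c : vec T) i :
  (forall x, vle c x -> X x) -> c i <= a i -> attains X a i.
Proof.
move=> cX ci; apply/asboolP; exists [ffun j => maxn (a j) (c j)]; split.
- by apply: cX => j; rewrite ffunE leq_maxr.
- by move=> j; rewrite ffunE leq_maxl.
- by rewrite ffunE; apply/maxn_idPl.
Qed.

(** The meet of one witness per coordinate is [a] itself; (G3) supplies the element above [a] from
    which the meets start. *)
Lemma attains_all (T : finType) (X : vset T) (a : vec T) :
  G1 X -> G3 X -> (forall i, attains X a i) -> X a.
Proof.
move=> X1 [c cX] att.
suff [x [Xx ax xa]] : exists x, [/\ X x, vle a x & {in enum T, forall i, x i = a i}].
  suff -> : a = x by [].
  by apply/ffunP => i; rewrite xa ?mem_enum.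
elim: (enum T) => [|i s [x [Xx ax xs]]].
  exists [ffun j => maxn (a j) (c j)]; split=> //.
    by apply: cX => j; rewrite ffunE leq_maxr.
  by move=> j; rewrite ffunE leq_maxl.
have /asboolP[y [Xy ay yi]] := att i.
exists (vmin x y); split; first exact: X1.
  by move=> j; rewrite ffunE leq_min ax ay.
move=> j; rewrite inE ffunE => /predU1P[->|/xs ->].
  by rewrite yi; apply/minn_idPr.
by apply/minn_idPl.
Qed.

Definition gap (T : finType) (S E : vset T) (a : vec T) (i : T) : nat :=
  attains S a i && ~~ attains E a i.

(** Since [E] lies in [S], a gap is the difference of the two [attains] values, so its square
    relation is the difference of those for [S] and [E]. *)
Lemma gap_potential (T : finType) (S E : vset T) (c : vec T) :
  G2 S -> G2 E -> (forall a, E a -> S a) -> (forall a, vle c a -> E a) ->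
  exists g : vec T -> nat,
    (forall (a : vec T) i, g a = gap S E a i + g (incr a i)) /\
    (forall a, vle c a -> g a = 0).
Proof.
move=> S2 E2 ES cE; apply: potential_exists => [a i k ne|a i le].
  have := attains_square a S2 ne; have := attains_square a E2 ne; rewrite /gap.
  have imp b j : attains E b j -> attains S b j by apply: attains_sub.
  move: (imp a i) (imp a k) (imp (incr a i) k) (imp (incr a k) i).
  by do 8!case: (attains _ _ _) => //=; move=> *; intuition.
by rewrite /gap (attains_big cE le) andbF.
Qed.

(** * Complete infima and floors *)

(** The sets [F] are forced: the coordinates on which an element equals [a]. They are nonempty
    because any other element of [s] exceeds [a] somewhere and meets the given one in [a]; [cover]
    makes their intersection empty. *)
Lemma complete_infimum_seq (T : finType) (S B : vset T) (a : vec T) (s : seq (vec T)) :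
  (forall x, B x -> S x) -> B a -> 1 < size s -> uniq s ->
  (forall x, x \in s -> B x /\ x <> a) ->
  {in s &, forall x y, x != y -> vmin x y = a} ->
  (forall i, exists2 x, x \in s & a i < x i) ->
  complete_infimum S B a (fun j : 'I_(size s) => nth a s j)
    (fun j => [set i | nth a s j i == a i]).
Proof.
move=> BS Ba s2 us Bs meet cover.
have mems (j : 'I_(size s)) : nth a s j \in s by apply: mem_nth.
have ge x y i : x \in s -> y \in s -> x != y -> a i = minn (x i) (y i).
  by move=> xs ys xy; rewrite -(meet x y) ?ffunE.
have other x : x \in s -> exists2 y, y \in s & x != y.
  move=> xs; have [/allP all_x|/allPn[y ys ne]] := boolP (all (pred1 x) s).
    have : size s <= size [:: x].
      by apply: uniq_leq_size => // y /all_x /eqP ->; rewrite inE.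
    by rewrite leqNgt s2.
  by exists y; rewrite // eq_sym.
have le x : x \in s -> vle a x.
  by move=> xs i; have [y ys ne] := other x xs; rewrite (ge x y i) // geq_minl.
split=> //.
- move=> j; have [Bj ne] := Bs _ (mems j); split=> //.
  + have [y ys jy] := other _ (mems j).
    have [i lt] := vle_neq (le y ys) (proj2 (Bs y ys)).
    apply/set0Pn; exists i; rewrite inE; apply/eqP.
    have := ge _ _ i (mems j) ys jy; rewrite /minn; case: ifP => // _ eq_a.
    by rewrite eq_a ltnn in lt.
  + have [i lt] := vle_neq (le _ (mems j)) ne.
    by apply: contraTneq lt => /setP/(_ i); rewrite !inE => /eqP ->; rewrite ltnn.
  + split; first exact: BS.
      by move=> i; rewrite inE => /eqP.
    by move=> i; rewrite inE ltn_neqAle eq_sym (le _ (mems j)) andbT.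
- by move=> j k jk; apply: meet => //; rewrite nth_uniq.
- apply/setP => i; rewrite inE; apply/bigcapP => in_all.
  have [x xs lt] := cover i; have jlt : index x s < size s by rewrite index_mem.
  by have := in_all (Ordinal jlt) isT; rewrite inE /= nth_index // gtn_eqF.
Qed.

Section Floor.
Context (T : finType) (S : vset T).

(* Raising one coordinate of [a] minimally: [x p] below is the least element of
   [S] above [a] that raises coordinate [p].  The sets of coordinates raised by
   the [x p] partition [T]. *)
Definition is_floor (a x : vec T) :=
  [/\ S x, vle a x & forall y, S y -> vle a y -> vle x y].

Context (S2 : G2 S) (a : vec T) (Sa : S a) (x : T -> vec T).
Context (flx : forall p, is_floor (incr a p) (x p)).

Lemma floor_gt p : a p < x p p.
Proof. by have [_ /(_ p)] := flx p; rewrite incrE eqxx addn1. Qed.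

Lemma floor_ge p : vle a (x p).
Proof. by have [_ le _] := flx p; apply: vle_trans le; apply: vle_incr. Qed.

Lemma floor_le p b : S b -> vle a b -> a p < b p -> vle (x p) b.
Proof. by have [_ _ min] := flx p => Sb ab lt; apply: min => //; apply: incr_vle. Qed.

(** (G2) for [a] and [b] at [p] gives an element above [a] that raises [p] and keeps every
    coordinate raised by [b]; [x p] lies below it. *)
Lemma floor_off p q b : S b -> vle a b -> b p = a p -> a q < b q -> x p q = a q.
Proof.
move=> Sb ab bp bq; have ne : a <> b by move=> e; rewrite e ltnn in bq.
have [|z [Sz [zp zj]]] := S2 Sa Sb ne (i := p); first by rewrite bp.
have qp : q != p by apply: contraTneq bq => ->; rewrite bp ltnn.
have min_a j : minn (a j) (b j) = a j by apply/minn_idPl.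
have az : vle a z.
  move=> j; have [->|jp] := eqVneq j p; first exact: ltnW.
  by have [+ _] := zj j jp; rewrite min_a.
apply/eqP; rewrite eqn_leq floor_ge andbT.
have [_ zq] := zj q qp; rewrite -[leqRHS](min_a q) -zq; first exact: floor_le.
by move=> e; rewrite e ltnn in bq.
Qed.

(** Minimality gives [x q] below [x p]. If [x q] kept [p], [floor_off] with [b] equal to [x q] would
    make [x p] keep [q]; so [x q] raises [p] and minimality gives the converse. *)
Lemma floor_eq p q : a q < x p q -> x p = x q.
Proof.
move=> lt; have [[Sp _ _] [Sq _ _]] := (flx p, flx q).
apply: vle_anti; last by apply: floor_le => //; apply: floor_ge.
apply: floor_le => //; first exact: floor_ge.
rewrite ltn_neqAle floor_ge andbT; apply/eqP => e.
have := floor_off Sq (floor_ge q) (esym e) (floor_gt q).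
by move=> e'; rewrite e' ltnn in lt.
Qed.

Lemma floor_meet p q : x p != x q -> vmin (x p) (x q) = a.
Proof.
move=> ne; apply/ffunP => r; rewrite ffunE; have [le|lt] := leqP (x p r) (a r).
  have -> : x p r = a r by apply/eqP; rewrite eqn_leq le floor_ge.
  exact/minn_idPl/floor_ge.
have [le'|lt'] := leqP (x q r) (a r).
  have -> : x q r = a r by apply/eqP; rewrite eqn_leq le' floor_ge.
  exact/minn_idPr/floor_ge.
by rewrite (floor_eq lt) (floor_eq lt') eqxx in ne.
Qed.

End Floor.

(** * Levels read off from the potential *)

Section Levels.
Context (T : finType) (S E : vset T) (c : vec T) (g : vec T -> nat).
Context (gS : good S) (gE : good E) (ES : forall a, E a -> S a).
Context (cE : forall a, vle c a -> E a).
Context (g_step : forall (a : vec T) i, g a = gap S E a i + g (incr a i)).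
Context (g_top : forall a, vle c a -> g a = 0).

Lemma g_anti (a b : vec T) : vle a b -> g b <= g a.
Proof.
move=> ab; apply: (vle_ind (P := fun x => g x <= g a) ab) => // x i _ _ _.
by rewrite (g_step x i); lia.
Qed.

Lemma g_step_le (a : vec T) i : g a <= (g (incr a i)).+1.
Proof. by rewrite (g_step a i) -add1n leq_add2r leq_b1. Qed.

Lemma gap_eq0 (a b : vec T) i : vle a b -> a i < b i -> g b = g a -> gap S E a i = 0.
Proof.
by move=> ab lt; have := g_anti (incr_vle ab lt); rewrite (g_step a i); lia.
Qed.

Lemma gap_notin (a : vec T) : S a -> ~ E a -> exists2 i, gap S E a i = 1 & ~~ attains E a i.
Proof.
move=> Sa nEa; have [/forallP all|] := boolP [forall i, attains E a i].
  by case: nEa; have [E1 _ E3] := gE; apply: attains_all.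
rewrite negb_forall => /existsP[i ni]; exists i => //.
by rewrite /gap attains_mem // ni.
Qed.

(** Raising a coordinate that [S] does not attain loses no element of [S] above [a] and crosses no
    gap. Such coordinates lie below [c], so the process stops, at a point of [S] by
    [attains_all]. *)
Lemma floor_exists (a : vec T) : exists x, is_floor S a x /\ g x = g a.
Proof.
have [n] := ubnP (\sum_j (c j - a j)); elim: n a => // n IH a /ltnSE le_n.
have [S1 _ S3] := gS.
have [/forallP all|] := boolP [forall i, attains S a i].
  by exists a; split=> //; split=> //; apply: attains_all.
rewrite negb_forall => /existsP[i ni].
have lt : a i < c i.
  by rewrite ltnNge; apply: contra ni; apply: attains_big => x /cE /ES.
have [x [[Sx ax min] gx]] := IH _ (leq_trans (sum_incr lt) le_n).
exists x; split; last by rewrite gx (g_step a i) /gap (negbTE ni).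
split=> // [|y Sy ay]; first by apply: vle_trans ax; apply: vle_incr.
apply: min => //; apply: incr_vle => //; rewrite ltn_neqAle ay andbT.
by apply: contra ni => /eqP e; apply/asboolP; exists y.
Qed.

Lemma floors_exist (a : vec T) : exists x : T -> vec T,
  forall p, is_floor S (incr a p) (x p) /\ g (x p) = g (incr a p).
Proof. exact: (fin_all_exists (fun p => floor_exists (incr a p))). Qed.

Lemma witness_above (a : vec T) : 0 < g a ->
  exists b, [/\ setdiff S E b, vle a b & g b = g a].
Proof.
have [n] := ubnP (\sum_j (c j - a j)); elim: n a => // n IH a /ltnSE le_n g0.
have [Ea|nEa] := pselect (setdiff S E a); first by exists a; split=> //; apply: vle_refl.
(* Outside [A] some step below [c] has no gap: any step when [a] is in [E], a step in an unattained
   coordinate when [a] is not in [S]. *)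
have [i lt gi] : exists2 i, a i < c i & gap S E a i = 0.
  have [Sa|nSa] := pselect (S a).
    have Ea' : E a by apply: contrapT => ?; apply: nEa.
    case: (pickP (fun i => a i < c i)) => [i lt|ge]; last first.
      by rewrite g_top // in g0 => i; rewrite leqNgt ge.
    by exists i; rewrite // /gap (attains_mem i Ea') andbF.
  have [S1 _ S3] := gS.
  have [/forallP all|] := boolP [forall i, attains S a i].
    by case: nSa; apply: attains_all.
  rewrite negb_forall => /existsP[i ni]; exists i; last by rewrite /gap (negbTE ni).
  by rewrite ltnNge; apply: contra ni; apply: attains_big => x /cE /ES.
have gb : g (incr a i) = g a by rewrite (g_step a i) gi.
have [|b [Ab ab gab]] := IH _ (leq_trans (sum_incr lt) le_n); first by rewrite gb.
by exists b; split=> //; [apply: vle_trans ab; apply: vle_incr|rewrite gab].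
Qed.

Definition succ_all (a : vec T) : vec T := [ffun i => (a i).+1].

Lemma vll_succ_all a b : vll a b <-> vle (succ_all a) b.
Proof. by split=> h i; have := h i; rewrite ffunE. Qed.

Lemma vll_vle (a b : vec T) : vll a b -> vle a b.
Proof. by move=> ab i; apply: ltnW. Qed.

Let A := setdiff S E.

Lemma g_vll a b : A a -> vll a b -> g b < g a.
Proof.
move=> [Sa nEa] ab; have [i gi _] := gap_notin Sa nEa.
have := g_anti (incr_vle (vll_vle ab) (ab i)).
by rewrite (g_step a i) gi.
Qed.

(** As the [F j] have empty intersection, some [beta j] raises the coordinate at which [a] has a
    gap, so [g] drops strictly from [a] to [beta j]. *)
Lemma g_cinf (B : vset T) k a : A a ->
  (forall b, B b -> k < g b) -> is_cinf S B a -> k.+1 < g a.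
Proof.
move=> [Sa nEa] Bk [r [beta [F [_ [r2 Ba bF _ cap]]]]].
have [i gi _] := gap_notin Sa nEa.
have [j iF] : exists j, i \notin F j.
  apply: contrapT => none; have : i \in \bigcap_(j < r) F j.
    by apply/bigcapP => j _; apply: contrapT => /negP ni; apply: none; exists j.
  by rewrite cap inE.
have [Bj _ _ [_ onF offF]] := bF j.
have ab : vle a (beta j).
  by move=> l; have [/onF->//|/offF/ltnW] := boolP (l \in F j).
have := gap_eq0 ab (offF i iF); have := g_anti ab; have := Bk _ Bj.
by rewrite gi; lia.
Qed.

(* No element of [E] above [a] keeps the coordinate [i0].  We take one element
   [b] of [A] that raises [i0], and the floors that keep every coordinate raised
   by [b]; these keep [i0], hence lie outside [E]. *)
Lemma cinf_of_g k a : A a -> k.+1 < g a -> g (succ_all a) <= k ->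
  is_cinf S (maximal (fun x => A x /\ k < g x)) a.
Proof.
move=> Aa ga gk; have [Sa nEa] := Aa; have [_ S2 _] := gS.
have [i0 _ nE0] := gap_notin Sa nEa.
have g_incr p : k < g (incr a p) by rewrite -ltnS; apply: leq_trans (g_step_le a p).
have [|b [Ab]] := witness_above (a := incr a i0).
  by apply: leq_ltn_trans (g_incr i0).
set X := fun _ => _; move=> ab gb.
have [x flx'] := floors_exist a.
have flx p := proj1 (flx' p); have gx p := proj2 (flx' p).
have a_b : vle a b by apply: vle_trans ab; apply: vle_incr.
have b0 : a i0 < b i0 by have := ab i0; rewrite incrE eqxx addn1.
(* An element strictly above [y] in all coordinates lies above [succ_all a], where [g] is at most
   [k]. *)
have maxX y : vle a y -> X y -> maximal X y.
  move=> ay Xy; split=> // -[z [[_ gz] yz]].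
  have : vll a z by move=> i; apply: leq_ltn_trans (ay i) (yz i).
  by move/vll_succ_all/g_anti; lia.
have xb p q : a p = b p -> a q < b q -> x p q = a q.
  by move=> e; apply: (floor_off S2 Sa flx) => //; case: Ab.
set s := b :: undup [seq x p | p <- enum T & a p == b p].
have sP y : y \in s -> y = b \/ exists2 p, a p = b p & y = x p.
  rewrite inE mem_undup => /predU1P[->|/mapP[p]]; first by left.
  by rewrite mem_filter => /andP[/eqP e _] ->; right; exists p.
have x_neq_b p : a p = b p -> x p != b.
  by move=> e; apply: contraTneq (floor_gt flx p) => ->; rewrite e ltnn.
(* This provides the second element of the family. *)
have [p0 e0] : exists p, a p = b p.
  apply: contrapT => none; suff /g_anti : vle (succ_all a) b by rewrite gb; have := g_incr i0; lia.
  move=> i; rewrite ffunE ltn_neqAle a_b andbT; apply/eqP => e; apply: none.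
  by exists i.
have xs p : a p = b p -> x p \in s.
  move=> e; rewrite inE mem_undup; apply/orP; right; apply: map_f.
  by rewrite mem_filter e eqxx mem_enum.
exists (size s), (fun j => nth a s j), (fun j => [set i | nth a s j i == a i]); split.
  (* Besides [b] there is at most one floor for each coordinate kept by [b], and [i0] is not kept:
     at most [#|T|] elements in all. *)
  rewrite /= (leq_ltn_trans (size_undup _)) // size_map size_filter.
  rewrite cardE -(count_predC (fun p => a p == b p) (enum T)).
  rewrite -[ltnLHS]addn0 ltn_add2l -has_count; apply/hasP; exists i0.
    by rewrite mem_enum.
  by rewrite /= neq_ltn b0.
apply: complete_infimum_seq => //.
- by move=> y [[[]]].
- by apply: maxX; [exact: vle_refl|split=> //; apply: ltnW].
- by rewrite /= ltnS -has_predT; apply/hasP; exists (x p0); rewrite // mem_undup;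
    apply: map_f; rewrite mem_filter e0 eqxx mem_enum.
- rewrite /= undup_uniq andbT mem_undup; apply/mapP => -[p].
  rewrite mem_filter => /andP[/eqP e _] /esym /eqP; exact/negP/x_neq_b.
- move=> y /sP[->|[p e ->]].
    split; last by move=> e; rewrite e ltnn in b0.
    by apply: maxX => //; split=> //; rewrite gb.
  split; last by move=> e'; have := floor_gt flx p; rewrite e' ltnn.
  apply: maxX; first exact: floor_ge flx p.
  split; last by rewrite gx.
  have [Sx _ _] := flx p; split=> // Ex; case/negP: nE0; apply/asboolP.
  by exists (x p); split=> //; [exact: floor_ge flx p|exact: xb].
- have bx p : a p = b p -> vmin (x p) b = a.
    move=> e; apply/ffunP => q; rewrite ffunE.
    have [le|lt] := leqP (b q) (a q); last by rewrite xb //; apply/minn_idPl.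
    have -> : b q = a q by apply/eqP; rewrite eqn_leq le a_b.
    exact/minn_idPr/(floor_ge flx).
  move=> y z /sP[->|[p ep ->]] /sP[->|[q eq ->]]; rewrite ?eqxx // => ne.
  + by rewrite -[RHS](bx q eq); apply/ffunP => i; rewrite !ffunE minnC.
  + exact: bx.
  + exact: (floor_meet S2 Sa flx).
- move=> i; have [le|lt] := leqP (b i) (a i); last by exists b; rewrite ?mem_head.
  exists (x i); last exact: (floor_gt flx).
  by apply: xs; apply/eqP; rewrite eqn_leq le a_b.
Qed.

(** Round [k.+1] removes exactly the elements with [g a = k.+1]: these are maximal by [g_vll] and no
    complete infima by [g_cinf]. If [g a] is larger, either [g (succ_all a)] exceeds [k] and [a] is
    not maximal by [witness_above], or [a] is a complete infimum by [cinf_of_g]. *)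
Lemma Rem_iff k a : Rem S A k a <-> A a /\ k < g a.
Proof.
elim: k a => [|k IH] a /=.
  split=> [Aa|[]//]; split=> //; have [Sa nEa] := Aa.
  by have [i gi _] := gap_notin Sa nEa; rewrite (g_step a i) gi.
have -> : Rem S A k = (fun x => A x /\ k < g x) by apply/funext => x; apply/propext.
set X := fun x => _; split=> [[[Aa ga] nD]|[Aa ga]].
  split=> //; apply: contrapT => le; apply: nD; split.
    split=> // -[b [[_ gb] ab]]; have := g_vll Aa ab; lia.
  by move/(g_cinf Aa (k := k)) => h; apply: le; apply: h => b [[_ gb] _].
split; first by split=> //; apply: ltnW.
case=> -[_ nmax] ncinf; have [le|lt] := leqP (g (succ_all a)) k.
  by apply: ncinf; apply: cinf_of_g.
have [|b [Ab ab gb]] := witness_above (a := succ_all a); first exact: leq_ltn_trans lt.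
by apply: nmax; exists b; rewrite /X gb; split=> //; apply/vll_succ_all.
Qed.

Lemma vzero_le (a : vec T) : vle (vzero T) a.
Proof. by move=> i; rewrite ffunE. Qed.

Lemma nlevels_iff N : nlevels S A N <-> N = g (vzero T).
Proof.
have ex M : (exists a, Rem S A M a) <-> M < g (vzero T).
  split=> [[a /Rem_iff[_ lt]]|lt].
    by apply: leq_trans lt _; apply/g_anti/vzero_le.
  have [|b [Ab _ gb]] := witness_above (a := vzero T); first exact: leq_ltn_trans lt.
  by exists b; apply/Rem_iff; rewrite gb.
split=> [[empty nonempty]|->].
  have [lt|lt|//] := ltngtP N (g (vzero T)).
    by have /ex[a /empty] := lt.
  by have /ex := nonempty _ lt; rewrite ltnn.
split=> [a Ra|M /ex//].
by have /ex : exists a, Rem S A (g (vzero T)) a; [exists a|rewrite ltnn].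
Qed.

Lemma Dof_iff k a : Dof S (Rem S A k) a <-> A a /\ g a = k.+1.
Proof.
have Rk := Rem_iff k a; have /= RkS := Rem_iff k.+1 a.
split=> [Da|[Aa ga]].
  have Ra : Rem S A k a by case: Da => -[].
  have [Aa ga] := proj1 Rk Ra; split=> //; apply/eqP; rewrite eqn_leq ga andbT.
  rewrite leqNgt; apply/negP => lt; have [_ nD] := proj2 RkS (conj Aa lt).
  exact: nD.
apply: contrapT => nD; have [] := proj1 RkS _.
  by split=> //; apply/Rk; rewrite ga.
by rewrite ga ltnn.
Qed.

(** With [N = g 0], the level [i] is removed in round [N - i + 1], that is, at [g a = N - i + 1]. *)
Lemma level_iff i a : level S A i a <-> A a /\ g a + i = (g (vzero T)).+1.
Proof.
have ga0 := g_anti (vzero_le a).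
split=> [[N [/nlevels_iff -> iN /Dof_iff[Aa ga]]]|[Aa ga]].
  by split=> //; rewrite ga; lia.
have gpos : 0 < g a by have [_] := proj1 (Rem_iff 0 a) Aa.
exists (g (vzero T)); split; [exact/nlevels_iff|by lia|apply/Dof_iff].
by split=> //; lia.
Qed.

End Levels.

(** * Gaps under projection *)

Section Projection.
Context (T : finType) (J : {set T}).

Lemma proj_good (X : vset T) : good X -> good (proj_set J X).
Proof.
case=> X1 X2 [c cX]; split.
- move=> _ _ [a [Xa <-]] [b [Xb <-]]; exists (vmin a b); split; first exact: X1.
  by apply/ffunP => i; rewrite !ffunE.
- move=> _ _ i [a [Xa <-]] [b [Xb <-]] ne; rewrite !ffunE => abi.
  have [|z [Xz [zi zj]]] := X2 a b (val i) Xa Xb _ abi.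
    by move=> ab; apply: ne; rewrite ab.
  exists (proj J z); split; first by exists z.
  rewrite !ffunE; split=> // j ji; rewrite !ffunE.
  by apply: zj; apply: contraNneq ji => /val_inj ->.
- exists (proj J c) => a ca.
  (* Lift [a] by filling the coordinates outside [J] from [c]. *)
  exists [ffun k => if insub k is Some i then a i else c k]; split.
    apply: cX => k; rewrite ffunE; case: insubP => // i _ <-.
    by have := ca i; rewrite ffunE.
  by apply/ffunP => i; rewrite !ffunE valK.
Qed.

(** Where [a] is 0, being above [a] is no condition, so any lift of a projected witness serves. *)
Lemma attains_proj (X : vset T) (a : vec T) (i : {i : T | i \in J}) :
  (forall k, k \notin J -> a k = 0) ->
  attains X a (val i) = attains (proj_set J X) (proj J a) i.
Proof.
move=> a0; apply/asboolP/asboolP => [[x [Xx ax xi]]|[_ [[x [Xx <-]] ax xi]]].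
  exists (proj J x); split; [by exists x| |by rewrite !ffunE].
  by move=> k; rewrite !ffunE.
exists x; split=> //; last by move: xi; rewrite !ffunE.
move=> k; have [kJ|/a0 ->//] := boolP (k \in J).
by have := ax (Sub k kJ); rewrite !ffunE.
Qed.

Lemma proj_incr (a : vec T) (i : {i : T | i \in J}) :
  proj J (incr a (val i)) = incr (proj J a) i.
Proof. by apply/ffunP => k; rewrite !ffunE. Qed.

(** Equality of the drops of [g] and [g1] from the origin, written with sums to avoid truncated
    subtraction. *)
Lemma potential_proj (S E : vset T) g g1 (a : vec T) :
  (forall (a : vec T) i, g a = gap S E a i + g (incr a i)) ->
  (forall (a : vec _) i,
    g1 a = gap (proj_set J S) (proj_set J E) a i + g1 (incr a i)) ->
  (forall k, k \notin J -> a k = 0) ->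
  g a + g1 (vzero _) = g (vzero T) + g1 (proj J a).
Proof.
move=> gs g1s a0.
apply: (vle_ind (P := fun x => g x + _ = _ + g1 (proj J x)) (vzero_le a)).
  by congr (_ + g1 _); apply/ffunP => i; rewrite !ffunE.
move=> x k _ xa lt; have kJ : k \in J by apply: contraTT lt => /a0 ->.
have x0 l : l \notin J -> x l = 0 by move/a0 => al; have := xa l; rewrite al leqn0 => /eqP.
have -> : k = val (Sub k kJ : {i : T | i \in J}) by [].
set i := Sub k kJ; rewrite proj_incr (gs x (val i)) (g1s (proj J x) i).
by rewrite /gap !(attains_proj _ _ x0) addnCA -addnA => /addnI.
Qed.

End Projection.

(** * Fibres of the projection under well-behavedness *)

Section WellBehaved.
Context (T : finType) (S E : vset T) (J : {set T}).
Context (gS : good S) (gE : good E) (ES : forall a, E a -> S a).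
Context (wb : well_behaved S E) (J0 : J != set0).

(* If the step were a gap at which [s] keeps coordinate [j], the floors at
   [a = s /\ al] would exhibit [a] as a complete infimum: the floor raising [j]
   keeps all of [J], so elements above [a] agreeing with [a] off its support lie
   in the fibre; the other floors keep [j].  Either way no element of [E] can
   occur, contradicting well-behavedness since [a] is not in [E]. *)
Lemma gap_fibre (al t : vec T) j :
  S al -> ~ proj_set J E (proj J al) -> (forall k, k \in J -> t k = al k) ->
  vle t al -> t j < al j -> gap S E t j = 0.
Proof.
move=> Sal nE tJ t_al lt; rewrite /gap.
have [/asboolP[s [Ss ts sj]]/=|//] := boolP (attains S t j).
apply/eqP; rewrite eqb0 negbK; apply: contrapT => /negP nEt.
have [S1 S2 _] := gS; have [_ E2 [c cE]] := gE.
set a := vmin s al; have Sa : S a by apply: S1.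
have aJ k : k \in J -> a k = al k.
  by move=> kJ; rewrite ffunE; apply/minn_idPr; rewrite -tJ.
have fibre y : E y -> ~ (forall k, k \in J -> y k = a k).
  move=> Ey ya; apply: nE; exists y; split=> //.
  by apply/ffunP => k; rewrite !ffunE ya ?aJ ?(valP k).
have nEa : ~ E a by move/fibre; apply.
have aj : a j = t j by rewrite ffunE sj; apply/minn_idPl/t_al.
have ta : vle t a by move=> k; rewrite ffunE leq_min ts t_al.
have a_al : vle a al by move=> k; rewrite ffunE geq_minr.
have [g [g_step g_top]] := gap_potential S2 E2 ES cE.
have [x flx'] := floors_exist gS ES cE g_step a.
have flx p := proj1 (flx' p).
(* As [al] itself raises [j], the floor [x j] lies below [al], which agrees with [a] on [J]. *)
have xj k : k \in J -> x j k = a k.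
  move=> kJ; apply/eqP; rewrite eqn_leq (floor_ge flx) andbT aJ //.
  by apply: (floor_le flx) => //; rewrite aj.
(* For [u] in [J], [x u] raises [u] and [x j] keeps it; so there are at least two floors. *)
have [u uJ] := set0Pn _ J0.
have xju : x j != x u.
  by apply: contraTneq (floor_gt flx u) => <-; rewrite xj // ltnn.
set l := undup (codom x).
have xl p : x p \in l by rewrite mem_undup codom_f.
have lP y : y \in l -> exists p, y = x p by rewrite mem_undup => /codomP.
have cinf : complete_infimum S S a (fun k : 'I_(size l) => nth a l k)
    (fun k => [set i | nth a l k i == a i]).
  apply: complete_infimum_seq => //.
  - apply: (@uniq_leq_size _ [:: x j; x u]); first by rewrite /= inE xju.
    by move=> y; rewrite !inE => /pred2P[] ->.
  - exact: undup_uniq.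
  - move=> y /lP[p ->]; have [Sx _ _] := flx p; split=> // e.
    by have := floor_gt flx p; rewrite e ltnn.
  - by move=> y z /lP[p ->] /lP[q ->]; apply: (floor_meet S2 Sa flx).
  - by move=> i; exists (x i); rewrite ?xl // (floor_gt flx).
(* Well-behavedness is used with [G] equal to [F]. *)
apply: nEa; apply: (wb cinf) => k.
have [_ _ /(_ k)[_ _ _ [Sb onF offF]] _ _] := cinf.
have [p kp] := lP _ (mem_nth a (ltn_ord k)).
split.
  split; [exact: Sb|exact: onF|by move=> i _; rewrite /= kp (floor_ge flx)|].
  by move=> /= e; have := floor_gt flx p; rewrite -kp e ltnn.
move=> e [Se on off _]; split=> // Ee.
have ae : vle a e by move=> i; have [/on->|/off] := boolP (i \in [set i | nth a l k i == a i]).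
have [jF|] := boolP (j \in [set i | nth a l k i == a i]).
  case/negP: nEt; apply/asboolP; exists e; split=> //; first exact: vle_trans ae.
  by rewrite on.
rewrite inE kp => ne; have xpj : x p = x j.
  by apply: (floor_eq S2 Sa flx); rewrite ltn_neqAle eq_sym ne (floor_ge flx).
by apply: (fibre e) => // i iJ; apply: on; rewrite inE kp xpj xj.
Qed.

Lemma potential_fibre g (al : vec T) :
  (forall (a : vec T) i, g a = gap S E a i + g (incr a i)) ->
  S al -> ~ proj_set J E (proj J al) ->
  g [ffun k => if k \in J then al k else 0] = g al.
Proof.
move=> gs Sal nE; set a0 := finfun _.
have a0J k : k \in J -> a0 k = al k by move=> kJ; rewrite ffunE kJ.
have le : vle a0 al by move=> k; rewrite ffunE; case: ifP.
apply/esym; apply: (vle_ind (P := fun x => g x = g a0) le) => // x i a0x xal lt <-.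
have xJ k : k \in J -> x k = al k.
  by move=> kJ; apply/eqP; rewrite eqn_leq xal -a0J // a0x.
by rewrite (gs x i) (gap_fibre Sal nE xJ xal lt).
Qed.

Lemma level_fibre i (al : vec T) :
  S al -> level (proj_set J S) (setdiff (proj_set J S) (proj_set J E)) i (proj J al) ->
  level S (setdiff S E) i al.
Proof.
move=> Sal; have [_ S2 _] := gS; have [_ E2 [c cE]] := gE.
have ES1 y : proj_set J E y -> proj_set J S y by case=> x [/ES Sx <-]; exists x.
have [gS1 gE1] := (proj_good J gS, proj_good J gE).
have [[_ S12 _] [_ E12 [c1 cE1]]] := (gS1, gE1).
have [g [gs gt]] := gap_potential S2 E2 ES cE.
have [g1 [g1s g1t]] := gap_potential S12 E12 ES1 cE1.
move/(level_iff gS1 gE1 ES1 cE1 g1s g1t) => [[_ nE] eq1].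
apply/(level_iff gS gE ES cE gs gt); split.
  by split=> // Eal; apply: nE; exists al.
(* The corner of the path from 0 to [al]: the coordinates in [J] are raised before it, the others
   after it. *)
set a0 := [ffun k => if k \in J then al k else 0] : vec T.
have zero k : k \notin J -> a0 k = 0 by rewrite ffunE => /negbTE ->.
have := potential_proj gs g1s zero; rewrite (potential_fibre gs Sal nE).
have -> : proj J a0 = proj J al by apply/ffunP => k; rewrite !ffunE (valP k).
by lia.
Qed.

End WellBehaved.

Theorem theorem5p6 (d : nat) (S E : vset 'I_d) (I1 : {set 'I_d}) :
  good_semigroup S -> local S -> good_ideal S E ->
  (exists x, S x /\ ~ E x) ->
  well_behaved S E ->
  I1 != set0 -> ~: I1 != set0 ->
  (forall (i : nat) (a1 : vec {k : 'I_d | k \in I1}),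
     level (proj_set I1 S) (setdiff (proj_set I1 S) (proj_set I1 E)) i a1 ->
     forall a, S a -> proj I1 a = a1 -> level S (setdiff S E) i a) /\
  (forall (i : nat) (a2 : vec {k : 'I_d | k \in ~: I1}),
     level (proj_set (~: I1) S) (setdiff (proj_set (~: I1) S) (proj_set (~: I1) E)) i a2 ->
     forall a, S a -> proj (~: I1) a = a2 -> level S (setdiff S E) i a).
Proof.
case=> _ _ S1 S2 S3 _ [ES _ E1 E2 E3] _ wb I1n0 I2n0.
have level_fibre' := level_fibre (And3 S1 S2 S3) (And3 E1 E2 E3) ES wb.
by split=> i a1 lev a Sa proj_a; rewrite -proj_a in lev; apply: level_fibre' lev.
Qed.
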